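(* Let $G$ be a hereditarily normal topological group. Then either (i) $G$ contains a non-trivial convergent sequence and $G$ has a $G_\delta$-diagonal, or (ii) $G$ contains no non-trivial convergent sequence and every compact subset of $G$ is finite. In either case every compact subset of $G$ is metrizable.
   Context: All spaces are assumed to be $T_1$. A space $X$ has a $G_\delta$-diagonal if $\{\langle x,x\rangle : x\in X\}$ is the intersection of a countable family of open subsets of $X\times X$. A non-trivial convergent sequence is a subspace homeomorphic to the subspace $\{0\}\cup\{1/n : n=1,2,3,\dots\}$ of the real line. *)

(* Defs.v *)
From Stdlib Require Import Reals List.
Open Scope R_scope.

Definition is_topology {X : Type} (op : (X -> Prop) -> Prop) : Prop :=
  op (fun _ => True) /\
  (forall U V, op U -> op V -> op (fun x => U x /\ V x)) /\
  (forall F : (X -> Prop) -> Prop, (forall U, F U -> op U) ->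
      op (fun x => exists U, F U /\ U x)) /\
  (forall U V, op U -> (forall x, U x <-> V x) -> op V).

Definition is_closed {X : Type} (op : (X -> Prop) -> Prop) (C : X -> Prop) : Prop :=
  op (fun x => ~ C x).

Definition T1 {X : Type} (op : (X -> Prop) -> Prop) : Prop :=
  forall a : X, is_closed op (fun x => x = a).

Definition subspace {X : Type} (op : (X -> Prop) -> Prop) (A : X -> Prop)
  : ({x : X | A x} -> Prop) -> Prop :=
  fun V => exists U, op U /\ forall y : {x : X | A x}, V y <-> U (proj1_sig y).

Definition prod_top {X Y : Type} (opX : (X -> Prop) -> Prop) (opY : (Y -> Prop) -> Prop)
  : (X * Y -> Prop) -> Prop :=
  fun W => forall p, W p -> exists U V, opX U /\ opY V /\ U (fst p) /\ V (snd p) /\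
      forall q, U (fst q) -> V (snd q) -> W q.

Definition continuous {X Y : Type} (opX : (X -> Prop) -> Prop) (opY : (Y -> Prop) -> Prop)
  (f : X -> Y) : Prop :=
  forall V, opY V -> opX (fun x => V (f x)).

Definition homeomorphic {X Y : Type} (opX : (X -> Prop) -> Prop) (opY : (Y -> Prop) -> Prop)
  : Prop :=
  exists (f : X -> Y) (g : Y -> X),
    (forall x, g (f x) = x) /\ (forall y, f (g y) = y) /\
    continuous opX opY f /\ continuous opY opX g.

Definition normal {X : Type} (op : (X -> Prop) -> Prop) : Prop :=
  forall A B : X -> Prop, is_closed op A -> is_closed op B ->
    (forall x, A x -> B x -> False) ->
    exists U V, op U /\ op V /\ (forall x, A x -> U x) /\ (forall x, B x -> V x) /\
      (forall x, U x -> V x -> False).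

Definition hereditarily_normal {X : Type} (op : (X -> Prop) -> Prop) : Prop :=
  forall A : X -> Prop, normal (subspace op A).

Definition compact_subset {X : Type} (op : (X -> Prop) -> Prop) (K : X -> Prop) : Prop :=
  forall F : (X -> Prop) -> Prop, (forall U, F U -> op U) ->
    (forall x, K x -> exists U, F U /\ U x) ->
    exists l : list (X -> Prop), (forall U, In U l -> F U) /\
      (forall x, K x -> exists U, In U l /\ U x).

Definition finite_set {X : Type} (K : X -> Prop) : Prop :=
  exists l : list X, forall x, K x -> In x l.

Definition is_metric {Y : Type} (d : Y -> Y -> R) : Prop :=
  (forall x y, 0 <= d x y) /\ (forall x y, d x y = 0 <-> x = y) /\
  (forall x y, d x y = d y x) /\ (forall x y z, d x z <= d x y + d y z).

Definition metric_open {Y : Type} (d : Y -> Y -> R) (U : Y -> Prop) : Prop :=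
  forall x, U x -> exists eps, 0 < eps /\ forall y, d x y < eps -> U y.

Definition metrizable {Y : Type} (op : (Y -> Prop) -> Prop) : Prop :=
  exists d : Y -> Y -> R, is_metric d /\ forall U, op U <-> metric_open d U.

Definition real_top : (R -> Prop) -> Prop := metric_open (fun x y => Rabs (x - y)).

Definition conv_seq_set (r : R) : Prop := r = 0 \/ exists n : nat, r = / INR (S n).

Definition has_nontrivial_conv_seq {X : Type} (op : (X -> Prop) -> Prop) : Prop :=
  exists A : X -> Prop, homeomorphic (subspace op A) (subspace real_top conv_seq_set).

Definition G_delta_diagonal {X : Type} (op : (X -> Prop) -> Prop) : Prop :=
  exists W : nat -> (X * X -> Prop), (forall n, prod_top op op (W n)) /\
    forall p : X * X, fst p = snd p <-> forall n, W n p.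

Definition is_group {G : Type} (mul : G -> G -> G) (inv : G -> G) (e : G) : Prop :=
  (forall x y z, mul x (mul y z) = mul (mul x y) z) /\
  (forall x, mul e x = x) /\ (forall x, mul x e = x) /\
  (forall x, mul (inv x) x = e) /\ (forall x, mul x (inv x) = e).

Definition is_topological_group {G : Type} (op : (G -> Prop) -> Prop)
  (mul : G -> G -> G) (inv : G -> G) (e : G) : Prop :=
  is_topology op /\ is_group mul inv e /\
  continuous (prod_top op op) op (fun p => mul (fst p) (snd p)) /\
  continuous op op inv.

(* Main.v *)
(** The first step is Katetov's argument on hereditarily normal products: if a sequence [D] of points
    other than [e] accumulates at [e], then the closure of [D] contains a G_delta subgroup [N] that
    misses [D]. If [D] converges to [e], then [N = {e}], so the diagonal is a G_delta, and compact
    subsets carry the Birkhoff-Kakutani metric. If [D] lies in an infinite compact set, then [N] is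
    compact and some points of [D] converge to [N]; replacing [N] by smaller and smaller subgroups,
    and the points by others in the same cosets, yields by Zorn's lemma a nontrivial sequence
    converging to [e]. *)

Require Import Defs.
From Stdlib Require Import Reals Arith List Lia Lra Classical ClassicalEpsilon.
From Stdlib Require Import ProofIrrelevance FunctionalExtensionality.
From mathcomp Require boolp classical_sets.

(** Shrinking the subgroup to a point may take uncountably many steps, and subsequences chosen at
    each step may have no common refinement along an uncountable chain. So no step passes to a
    subsequence: the [n]-th point only moves inside its own coset, and at limit stages compactness
    of the cosets supplies a point common to all of them. Every point stays outside the first
    subgroup [N0], which contains [e]; hence the sequence obtained at the end never takes the value
    of its limit. *)

Lemma choice_fun {A B : Type} (P : A -> B -> Prop) :
  (forall a, exists b, P a b) -> exists f : A -> B, forall a, P a (f a).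
Proof.
  intros H. exists (fun a => proj1_sig (constructive_indefinite_description _ (H a))).
  intros a. exact (proj2_sig (constructive_indefinite_description _ (H a))).
Qed.

Definition closure {X : Type} (op : (X -> Prop) -> Prop) (A : X -> Prop) (x : X) : Prop :=
  forall U, op U -> U x -> exists y, U y /\ A y.

Definition Hausdorff {X : Type} (op : (X -> Prop) -> Prop) : Prop :=
  forall x y, x <> y -> exists U V, op U /\ op V /\ U x /\ V y /\ forall z, U z -> V z -> False.

Definition converges {X : Type} (op : (X -> Prop) -> Prop) (x : nat -> X) (p : X) : Prop :=
  forall U, op U -> U p -> exists N, forall n, (N <= n)%nat -> U (x n).

(** * General topology: closures, compactness and separation *)

Section Topology.
Local Open Scope nat_scope.
Context {X : Type} {op : (X -> Prop) -> Prop} (top : is_topology op).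

Lemma open_true : op (fun _ => True).
Proof. apply top. Qed.

Lemma open_ext U V : op U -> (forall x, U x <-> V x) -> op V.
Proof. destruct top as (_ & _ & _ & H). apply H. Qed.

Lemma open_and U V : op U -> op V -> op (fun x => U x /\ V x).
Proof. apply top. Qed.

Lemma open_local W :
  (forall x, W x -> exists U, op U /\ U x /\ forall y, U y -> W y) -> op W.
Proof.
  intros H. destruct top as (_ & _ & Hun & _).
  apply open_ext with (fun x => exists U, (op U /\ forall y, U y -> W y) /\ U x).
  - apply Hun. tauto.
  - intros x; split.
    + intros (U & (_ & HU) & Ux). auto.
    + intros Wx. destruct (H x Wx) as (U & ? & ? & ?). exists U; auto.
Qed.

Lemma open_or U V : op U -> op V -> op (fun x => U x \/ V x).
Proof.
  intros HU HV. apply open_local. intros x [Ux | Vx]; [exists U | exists V]; auto.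
Qed.

Lemma closed_inter {I : Type} (C : I -> X -> Prop) :
  (forall i, is_closed op (C i)) -> is_closed op (fun x => forall i, C i x).
Proof.
  intros HC. apply open_local. intros x Hx. apply not_all_ex_not in Hx.
  destruct Hx as (i & Hi). exists (fun y => ~ C i y). repeat split; auto.
  apply HC.
Qed.

Lemma closed_and C D : is_closed op C -> is_closed op D -> is_closed op (fun x => C x /\ D x).
Proof.
  intros HC HD. apply open_ext with (fun x => ~ C x \/ ~ D x).
  - apply open_or; assumption.
  - intros x; split; [tauto | apply not_and_or].
Qed.

Lemma not_closure A x :
  ~ closure op A x -> exists U, op U /\ U x /\ forall y, U y -> ~ A y.
Proof.
  intros H. apply not_all_ex_not in H. destruct H as (U & HU).
  exists U. split; [tauto | split; [tauto |]].
  intros y Uy Ay. apply HU. intros _ _. exists y; auto.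
Qed.

Lemma closure_closed A : is_closed op (closure op A).
Proof.
  apply open_local. intros x Hx. destruct (not_closure A x Hx) as (U & HU & Ux & HA).
  exists U. repeat split; auto. intros y Uy Hy.
  destruct (Hy U HU Uy) as (z & Uz & Az). exact (HA z Uz Az).
Qed.

Lemma subset_closure (A : X -> Prop) x : A x -> closure op A x.
Proof. intros Ax U _ Ux. exists x; auto. Qed.

Lemma closure_min (A C : X -> Prop) :
  is_closed op C -> (forall x, A x -> C x) -> forall x, closure op A x -> C x.
Proof.
  intros HC HA x Hx. apply NNPP. intros Nx.
  destruct (Hx _ HC Nx) as (y & Ny & Ay). auto.
Qed.

Lemma open_avoid_finite (T : T1 op) (x : nat -> X) z N :
  exists O, op O /\ O z /\ forall n, n < N -> x n <> z -> ~ O (x n).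
Proof.
  induction N as [| N (O & HO & Oz & H)].
  - exists (fun _ => True). split; [apply open_true | split; auto]. intros; lia.
  - destruct (classic (x N = z)) as [E | E].
    + exists O. repeat split; auto. intros n Hn En.
      apply H; auto. destruct (Nat.eq_dec n N) as [-> | ?]; [contradiction | lia].
    + exists (fun y => O y /\ ~ y = x N). split; [| split].
      * apply open_and; auto. apply T.
      * auto.
      * intros n Hn En [On Hne]. destruct (Nat.eq_dec n N) as [-> | ?]; [auto |].
        apply (H n); auto; lia.
Qed.

(** A neighbourhood of [z] disjoint from one of [p] excludes all but finitely many terms, and T1
    excludes the rest. [C] may omit terms, so the lemma also covers images of arbitrary sets of
    indices together with the limit. *)
Lemma convergent_range_closed (T : T1 op) (Hd : Hausdorff op) (x : nat -> X) p C :
  converges op x p -> C p -> (forall z, C z -> z = p \/ exists n, z = x n) ->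
  is_closed op C.
Proof.
  intros Hx Cp HC. apply open_local. intros z Nz.
  destruct (Hd z p) as (U & V & HU & HV & Uz & Vp & Dis); [congruence |].
  destruct (Hx V HV Vp) as (N & HN).
  destruct (open_avoid_finite T x z N) as (O & HO & Oz & HON).
  exists (fun y => U y /\ O y). split; [apply open_and; auto | split; auto].
  intros y (Uy & Oy) Cy. destruct (HC y Cy) as [-> | (n & ->)].
  - exact (Dis p Uy Vp).
  - destruct (le_lt_dec N n) as [L | L].
    + exact (Dis _ Uy (HN n L)).
    + apply (HON n); auto. intros E. congruence.
Qed.

Lemma compact_subset_closed (K L : X -> Prop) :
  compact_subset op K -> is_closed op L -> (forall x, L x -> K x) -> compact_subset op L.
Proof.
  intros HK HL LK F HF Cov.
  destruct (HK (fun U => F U \/ U = fun x => ~ L x)) as (l & Hl & Hc).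
  - intros U [FU | ->]; auto.
  - intros x _. destruct (classic (L x)) as [Lx | Lx].
    + destruct (Cov x Lx) as (U & ? & ?). exists U; auto.
    + eexists; split; [right; reflexivity | auto].
  - assert (D : exists l', (forall U, In U l' -> F U) /\
        forall x, L x -> (exists U, In U l /\ U x) -> exists U, In U l' /\ U x).
    { clear Hc. induction l as [| U l IH].
      - exists nil. split; [intros U [] | intros x _ (U & [] & _)].
      - destruct IH as (l' & H1 & H2). { intros V HV; apply Hl; right; auto. }
        destruct (Hl U (or_introl eq_refl)) as [FU | ->].
        + exists (U :: l'). split.
          * intros V [<- | HV]; auto.
          * intros x Lx (V & [<- | HV] & Vx).
            -- exists U. split; [left; auto | auto].
            -- destruct (H2 x Lx) as (W & ? & ?); [eauto |]. exists W. split; [right|]; auto.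
        + exists l'. split; auto. intros x Lx (V & [<- | HV] & Vx); [contradiction|].
          apply H2; eauto. }
    destruct D as (l' & H1 & H2). exists l'. split; auto.
Qed.

(** [O] and the complements of the members of [F] cover [K]; directedness merges the finitely many
    complements of a subcover into one. With [O] empty this is the finite intersection property. *)
Lemma compact_directed (K : X -> Prop) (F : (X -> Prop) -> Prop) (O : X -> Prop) :
  compact_subset op K -> (exists C, F C) -> (forall C, F C -> is_closed op C) ->
  (forall C D, F C -> F D -> exists B, F B /\ forall x, B x -> C x /\ D x) ->
  op O -> (forall x, K x -> (forall C, F C -> C x) -> O x) ->
  exists C, F C /\ forall x, K x -> C x -> O x.
Proof.
  intros HK (C0 & FC0) HF Dir HO HKO.
  destruct (HK (fun U => U = O \/ exists C, F C /\ U = fun x => ~ C x)) as (l & Hl & Hc).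
  - intros U [-> | (C & FC & ->)]; [auto | apply HF; auto].
  - intros x Kx. destruct (classic (O x)) as [Ox | Ox].
    + exists O; auto.
    + assert (H : ~ forall C, F C -> C x) by auto.
      apply not_all_ex_not in H. destruct H as (C & HC).
      exists (fun x => ~ C x). split; [right; exists C |]; tauto.
  - assert (D : exists C, F C /\ forall x, C x -> (exists U, In U l /\ U x) -> O x).
    { clear Hc. induction l as [| U l IH].
      - exists C0. split; auto. intros x _ (U & [] & _).
      - destruct IH as (C & FC & H2). { intros V HV; apply Hl; right; auto. }
        destruct (Hl U (or_introl eq_refl)) as [-> | (D & FD & ->)].
        + exists C. split; auto. intros x Cx (V & [<- | HV] & Vx); eauto.
        + destruct (Dir C D FC FD) as (B & FB & HB). exists B. split; auto.
          intros x Bx (V & [<- | HV] & Vx).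
          * destruct (HB x Bx); contradiction.
          * apply H2; eauto. apply HB; auto. }
    destruct D as (C & FC & H). exists C. split; auto.
Qed.

Lemma compact_antitone (K : X -> Prop) (C : nat -> X -> Prop) (O : X -> Prop) :
  compact_subset op K -> (forall n, is_closed op (C n)) ->
  (forall n x, C (S n) x -> C n x) ->
  op O -> (forall x, K x -> (forall n, C n x) -> O x) ->
  exists n, forall x, K x -> C n x -> O x.
Proof.
  intros HK HC Dec HO H.
  assert (Mono : forall m n, m <= n -> forall x, C n x -> C m x).
  { intros m n L. induction L; auto. }
  destruct (compact_directed K (fun B => exists n, B = C n) O) as (B & (n & ->) & HB); auto.
  - exists (C 0). exists 0; auto.
  - intros B (n & ->); auto.
  - intros A B (n & ->) (m & ->). exists (C (Nat.max n m)). split; eauto.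
    intros x Hx. split; apply (Mono _ (Nat.max n m)); auto; lia.
  - intros x Kx Hx. apply H; auto. intros n. apply Hx. eauto.
  - eauto.
Qed.

(** In a Hausdorff space the closures of the neighbourhoods of [z] meet only in [z], and they form a
    directed family; if [z] is outside [K], one of them misses [K]. *)
Lemma compact_closed (K : X -> Prop) : Hausdorff op -> compact_subset op K -> is_closed op K.
Proof.
  intros Hd HK. apply open_local. intros z Nz.
  destruct (compact_directed K (fun B => exists U, op U /\ U z /\ B = closure op U)
              (fun _ => False)) as (B & (U & HU & Uz & ->) & HB); auto.
  - exists (closure op (fun _ => True)). exists (fun _ => True).
    split; [apply open_true | auto].
  - intros B (U & _ & _ & ->). apply closure_closed.
  - intros A B (U & HU & Uz & ->) (V & HV & Vz & ->).
    exists (closure op (fun x => U x /\ V x)). split.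
    + exists (fun x => U x /\ V x). split; [apply open_and |]; auto.
    + intros x Hx; split; intros O HO Ox; destruct (Hx O HO Ox) as (y & ? & ? & ?); eauto.
  - apply open_local. intros x [].
  - intros x Kx H. destruct (Hd x z) as (U & V & HU & HV & Ux & Vz & Dis); [congruence |].
    destruct (H (closure op V)) with U as (y & ? & ?); eauto.
  - exists U. repeat split; auto. intros y Uy Ky. apply (HB y Ky). apply subset_closure; auto.
Qed.

(** Off [C1 /\ C2] the two sets are disjoint and relatively closed, so normality of that subspace
    applies. The subspace is open, hence the separating sets are open in the whole space. *)
Lemma hereditarily_normal_differences C1 C2 :
  hereditarily_normal op -> is_closed op C1 -> is_closed op C2 ->
  exists P Q, op P /\ op Q /\ (forall x, C1 x -> ~ C2 x -> P x) /\
    (forall x, C2 x -> ~ C1 x -> Q x) /\ (forall x, P x -> Q x -> False).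
Proof.
  intros HN H1 H2. set (Y := fun x => ~ (C1 x /\ C2 x)).
  assert (HY : op Y) by (apply closed_and; auto).
  destruct (HN Y (fun y => C1 (proj1_sig y)) (fun y => C2 (proj1_sig y)))
    as (U & V & (U' & HU & EU) & (V' & HV & EV) & HA & HB & Dis).
  - exists (fun x => ~ C1 x). split; [exact H1 | tauto].
  - exists (fun x => ~ C2 x). split; [exact H2 | tauto].
  - intros (x & Hx) A B. apply Hx; auto.
  - exists (fun x => U' x /\ Y x), (fun x => V' x /\ Y x).
    split; [apply open_and; auto |]. split; [apply open_and; auto |].
    split; [| split].
    + intros x A B. assert (Yx : Y x) by (unfold Y; tauto). split; auto.
      apply (EU (exist _ x Yx)). apply HA. exact A.
    + intros x A B. assert (Yx : Y x) by (unfold Y; tauto). split; auto.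
      apply (EV (exist _ x Yx)). apply HB. exact A.
    + intros x (A & Yx) (B & _). apply (Dis (exist _ x Yx)); [apply EU | apply EV]; auto.
Qed.

Lemma finite_compact_metrizable (K : X -> Prop) :
  T1 op -> finite_set K -> metrizable (subspace op K).
Proof.
  intros T (l & Hl).
  set (d := fun x y : {x | K x} => if excluded_middle_informative (x = y) then 0%R else 1%R).
  assert (Hd : forall x y, (x = y /\ d x y = 0%R) \/ (x <> y /\ d x y = 1%R)).
  { intros x y. unfold d. destruct (excluded_middle_informative (x = y)); auto. }
  exists d. split; [split; [| split; [| split]] |].
  - intros x y. destruct (Hd x y); lra.
  - intros x y. destruct (Hd x y); split; intros; try tauto; lra.
  - intros x y. destruct (Hd x y) as [[? ->] | [? ->]], (Hd y x) as [[? ->] | [? ->]];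
      try reflexivity; subst; contradiction.
  - intros x y z. destruct (Hd x y) as [[? ->] | [? ->]], (Hd y z) as [[? ->] | [? ->]],
      (Hd x z) as [[? ->] | [? ->]]; try lra; subst; contradiction.
  - intros V. split; intros _.
    + intros x Vx. exists 1%R. split; [lra |]. intros y Hy.
      destruct (Hd x y) as [[<- _] | [_ E]]; [auto | lra].
    + exists (fun x => forall y : {x | K x}, x = proj1_sig y -> V y). split.
      * cut (forall l', op (fun x => forall y : {x | K x}, In (proj1_sig y) l' ->
               x = proj1_sig y -> V y)).
        { intros H. eapply open_ext; [apply (H l) |]. intros x; split; auto.
          intros Hx (y & Ky) E. apply Hx; auto. }
        intros l'. induction l' as [| a l' IH].
        -- eapply open_ext; [apply open_true |]. intros x; split; auto. intros _ y [].
        -- destruct (classic (forall y : {x | K x}, proj1_sig y = a -> V y)) as [Va | Va].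
           ++ eapply open_ext; [apply IH |]. intros x; split.
              ** intros H y [E | I] Exy; [apply Va | apply H]; auto.
              ** intros H y I Exy; apply H; auto; right; auto.
           ++ eapply open_ext; [apply (open_and _ _ IH (T a)) |]. intros x; split.
              ** intros (H & Nx) y [E | I] Exy; [exfalso; apply Nx; congruence | apply H; auto].
              ** intros H; split; [intros y I; apply H; right; auto |].
                 intros ->. apply Va. intros y <-. apply H; auto. left; auto.
      * intros (y & Ky); simpl. split.
        -- intros Vy (z & Kz) E. simpl in E. subst z. rewrite (proof_irrelevance _ Kz Ky). exact Vy.
        -- intros H. apply H. reflexivity.
Qed.

End Topology.

(** * Convergent sequences as subspaces *)

Lemma homeomorphic_sym {X Y : Type} (opX : (X -> Prop) -> Prop) (opY : (Y -> Prop) -> Prop) :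
  homeomorphic opX opY -> homeomorphic opY opX.
Proof. intros (f & g & H1 & H2 & H3 & H4). exists g, f. auto. Qed.

Lemma homeomorphic_trans {X Y Z : Type} (opX : (X -> Prop) -> Prop)
  (opY : (Y -> Prop) -> Prop) (opZ : (Z -> Prop) -> Prop) :
  homeomorphic opX opY -> homeomorphic opY opZ -> homeomorphic opX opZ.
Proof.
  intros (f & g & H1 & H2 & H3 & H4) (f' & g' & H1' & H2' & H3' & H4').
  exists (fun x => f' (f x)), (fun z => g (g' z)). repeat split.
  - intros x. rewrite H1'. apply H1.
  - intros z. rewrite H2. apply H2'.
  - intros V HV. exact (H3 _ (H3' V HV)).
  - intros V HV. exact (H4' _ (H4 V HV)).
Qed.

(* The one-point compactification of the discrete space [nat], with [None] as point at infinity. *)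
Definition sequence_top (V : option nat -> Prop) : Prop :=
  V None -> exists N, forall n, (N <= n)%nat -> V (Some n).

Lemma injective_sequence_homeomorphic {X : Type} (op : (X -> Prop) -> Prop)
  (a : option nat -> X) (A : X -> Prop) :
  is_topology op -> T1 op -> Hausdorff op ->
  (forall o o', a o = a o' -> o = o') -> converges op (fun n => a (Some n)) (a None) ->
  (forall x, A x <-> exists o, x = a o) ->
  homeomorphic (subspace op A) sequence_top.
Proof.
  intros top T Hd Inj Cv HA.
  destruct (choice_fun (fun (x : {x | A x}) o => proj1_sig x = a o)) as (f & Hf).
  { intros (x & Ax). apply HA. exact Ax. }
  assert (Aa : forall o, A (a o)) by (intros o; apply HA; eauto).
  exists f, (fun o => exist _ (a o) (Aa o)). repeat split.
  - intros x. generalize (Aa (f x)). rewrite <- (Hf x). destruct x as (x & Ax); simpl.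
    intros Ax'. rewrite (proof_irrelevance _ Ax' Ax). reflexivity.
  - intros o. apply Inj. rewrite <- Hf. reflexivity.
  (* The deleted set, the image of the complement of [V], is closed: it is finite if [V] contains
     [None], and otherwise it contains the limit. *)
  - intros V HV. exists (fun z => ~ exists o, ~ V o /\ z = a o). split.
    + change (is_closed op (fun z => exists o, ~ V o /\ z = a o)).
      destruct (classic (V None)) as [VN | VN].
      * destruct (HV VN) as (N & HN). apply (open_local top). intros z Nz.
        destruct (open_avoid_finite top T (fun n => a (Some n)) z N) as (O & HO & Oz & HON).
        exists O. repeat split; auto. intros y Oy ([n |] & Vn & ->); [| contradiction].
        apply (HON n); auto.
        -- destruct (le_lt_dec N n); auto. destruct Vn; auto.
        -- intros E. apply Nz. exists (Some n). auto.
      * apply convergent_range_closed with (2 := T) (3 := Hd) (4 := Cv); auto.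
        -- exists None; auto.
        -- intros z ([n |] & _ & ->); eauto.
    + intros x. split.
      * intros Vx (o & Vo & E). apply Vo. rewrite (Hf x) in E. apply Inj in E. congruence.
      * intros H. apply NNPP. intros Nx. apply H. exists (f x). auto.
  - intros V (U & HU & EU) VN. destruct (Cv U HU) as (N & HN).
    { apply (EU (exist _ (a None) (Aa None))). exact VN. }
    exists N. intros n Hn. apply EU. apply HN. exact Hn.
Qed.

Lemma real_top_topology : is_topology real_top.
Proof.
  split; [| split; [| split]].
  - intros x _. exists 1. split; [lra | auto].
  - intros U V HU HV x (Ux & Vx). destruct (HU x Ux) as (r & Hr & Br).
    destruct (HV x Vx) as (s & Hs & Bs). exists (Rmin r s). split.
    + apply Rmin_pos; auto.
    + intros y Hy. pose proof (Rmin_l r s). pose proof (Rmin_r r s).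
      split; [apply Br | apply Bs]; lra.
  - intros F HF x (U & FU & Ux). destruct (HF U FU x Ux) as (r & Hr & Br).
    exists r. split; eauto.
  - intros U V HU E x Vx. apply E in Vx. destruct (HU x Vx) as (r & Hr & Br).
    exists r. split; auto. intros y Hy. apply E; auto.
Qed.

Lemma real_top_ball x r : real_top (fun y => Rabs (y - x) < r).
Proof.
  intros y Hy. exists (r - Rabs (y - x)). split; [lra |]. intros z Hz.
  replace (z - x) with ((z - y) + (y - x)) by ring.
  pose proof (Rabs_triang (z - y) (y - x)). rewrite (Rabs_minus_sym y z) in Hz. lra.
Qed.

Lemma real_top_hausdorff : Hausdorff real_top.
Proof.
  intros x y Hxy.
  assert (P : 0 < Rabs (x - y)) by (apply Rabs_pos_lt; lra).
  exists (fun z => Rabs (z - x) < Rabs (x - y) / 2), (fun z => Rabs (z - y) < Rabs (x - y) / 2).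
  repeat split; try apply real_top_ball.
  - rewrite Rminus_diag, Rabs_R0; lra.
  - rewrite Rminus_diag, Rabs_R0; lra.
  - intros z Hx Hy. replace (x - y) with (- (z - x) + (z - y)) in * by ring.
    pose proof (Rabs_triang (- (z - x)) (z - y)) as Ht. rewrite Rabs_Ropp in Ht. lra.
Qed.

Lemma hausdorff_T1 {X : Type} (op : (X -> Prop) -> Prop) :
  is_topology op -> Hausdorff op -> T1 op.
Proof.
  intros top Hd a. apply (open_local top). intros x Hx.
  destruct (Hd x a Hx) as (U & V & HU & HV & Ux & Va & Dis).
  exists U. repeat split; auto. intros y Uy ->. eauto.
Qed.

Lemma inv_INR_S_converges : converges real_top (fun n => / INR (S n)) 0.
Proof.
  intros U HU U0. destruct (HU 0 U0) as (r & Hr & Br).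
  destruct (archimed_cor1 r Hr) as (N & HN & PN). exists N. intros n Hn. apply Br.
  assert (0 < / INR (S n)) by (apply Rinv_0_lt_compat, lt_0_INR; lia).
  rewrite Rabs_minus_sym, Rminus_0_r, Rabs_pos_eq by lra.
  eapply Rle_lt_trans; [| exact HN]. apply Rinv_le_contravar.
  - apply lt_0_INR; lia.
  - apply le_INR; lia.
Qed.

Lemma conv_seq_set_homeomorphic : homeomorphic (subspace real_top conv_seq_set) sequence_top.
Proof.
  assert (P : forall n, 0 < / INR (S n)) by (intros; apply Rinv_0_lt_compat, lt_0_INR; lia).
  apply injective_sequence_homeomorphic
    with (a := fun o => match o with None => 0 | Some n => / INR (S n) end).
  - exact real_top_topology.
  - exact (hausdorff_T1 _ real_top_topology real_top_hausdorff).
  - exact real_top_hausdorff.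
  - intros [n |] [m |] E; try reflexivity.
    + apply Rinv_eq_reg in E. apply INR_eq in E. congruence.
    + specialize (P n). lra.
    + specialize (P m). lra.
  - exact inv_INR_S_converges.
  - intros x. split.
    + intros [-> | (n & ->)]; [exists None | exists (Some n)]; reflexivity.
    + intros ([n |] & ->); [right; eauto | left; reflexivity].
Qed.

Lemma converges_subsequence {X : Type} (op : (X -> Prop) -> Prop) (x : nat -> X) (p : X)
  (phi : nat -> nat) :
  (forall n, (n <= phi n)%nat) -> converges op x p -> converges op (fun n => x (phi n)) p.
Proof.
  intros Hphi Cv U HU Up. destruct (Cv U HU Up) as (N & HN). exists N. intros n Hn.
  apply HN. specialize (Hphi n). lia.
Qed.

(** No term equals the limit, so by T1 each value recurs only finitely often; [M n] is an index
    beyond all recurrences of [x n], and iterating [M] gives the subsequence. *)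
Lemma injective_subsequence {X : Type} (op : (X -> Prop) -> Prop) (x : nat -> X) (p : X) :
  T1 op -> converges op x p -> (forall n, x n <> p) ->
  exists phi : nat -> nat, (forall n, (n <= phi n)%nat) /\
    forall n m, x (phi n) = x (phi m) -> n = m.
Proof.
  intros T Cv Hp.
  destruct (choice_fun (fun n M => (n < M)%nat /\ forall m, (M <= m)%nat -> x m <> x n))
    as (M & HM).
  { intros n. destruct (Cv _ (T (x n))) as (N & HN); [intros E; symmetry in E; exact (Hp n E) |].
    exists (S (Nat.max n N)). split; [lia |]. intros m Hm. apply HN. lia. }
  set (phi := nat_rect (fun _ => nat) 0%nat (fun _ k => M k)).
  assert (Step : forall n, (phi n < phi (S n))%nat) by (intros n; apply HM).
  assert (Mono : forall n m, (n <= m)%nat -> (phi n <= phi m)%nat).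
  { intros n m L. induction L; [lia |]. specialize (Step m). lia. }
  assert (Ne : forall n m, (n < m)%nat -> x (phi m) <> x (phi n)).
  { intros n m L. apply HM. apply (Mono (S n) m). lia. }
  exists phi. split.
  - intros n. induction n; [lia |]. specialize (Step n). lia.
  - intros n m E. destruct (lt_eq_lt_dec n m) as [[L | L] | L]; auto; exfalso.
    + apply (Ne n m L). auto.
    + apply (Ne m n L). auto.
Qed.

Lemma conv_seq_of_sequence {X : Type} (op : (X -> Prop) -> Prop) (x : nat -> X) (p : X) :
  is_topology op -> Hausdorff op -> converges op x p -> (forall n, x n <> p) ->
  has_nontrivial_conv_seq op.
Proof.
  intros top Hd Cv Hp. assert (T := hausdorff_T1 op top Hd).
  destruct (injective_subsequence op x p T Cv Hp) as (phi & Hphi & Inj).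
  set (a := fun o => match o with None => p | Some n => x (phi n) end).
  exists (fun z => exists o, z = a o).
  apply homeomorphic_trans with (2 := homeomorphic_sym _ _ conv_seq_set_homeomorphic).
  apply injective_sequence_homeomorphic with a; auto.
  - intros [n |] [m |] E; simpl in E; try reflexivity.
    + f_equal. auto.
    + destruct (Hp _ E).
    + destruct (Hp (phi m)). auto.
  - exact (converges_subsequence op x p phi Hphi Cv).
  - tauto.
Qed.

Lemma sequence_of_conv_seq {X : Type} (op : (X -> Prop) -> Prop) :
  has_nontrivial_conv_seq op ->
  exists (x : nat -> X) (p : X), converges op x p /\ forall n, x n <> p.
Proof.
  intros (A & HA).
  destruct (homeomorphic_trans _ _ _ HA conv_seq_set_homeomorphic) as (f & g & _ & fg & _ & Cg).
  exists (fun n => proj1_sig (g (Some n))), (proj1_sig (g None)). split.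
  - intros U HU Up.
    apply (Cg (fun y => U (proj1_sig y))); [| exact Up].
    exists U. split; auto. tauto.
  - intros n E.
    assert (E' : g (Some n) = g None).
    { destruct (g (Some n)) as (y & Ay), (g None) as (z & Az). simpl in E. subst z.
      rewrite (proof_irrelevance _ Ay Az). reflexivity. }
    apply (f_equal f) in E'. rewrite !fg in E'. discriminate.
Qed.

(** * Sequences in infinite and in compact sets *)

Lemma infinite_injective_sequence {X : Type} (K : X -> Prop) :
  ~ finite_set K ->
  exists x : nat -> X, (forall n, K (x n)) /\ forall n m, x n = x m -> n = m.
Proof.
  intros Inf. destruct (choice_fun (fun l z => K z /\ ~ In z l)) as (f & Hf).
  { intros l. apply NNPP. intros H. apply Inf. exists l. intros z Kz.
    apply NNPP. intros Nz. apply H. eauto. }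
  set (L := nat_rect (fun _ => list X) nil (fun _ l => f l :: l)).
  assert (HL : forall n m, (n < m)%nat -> In (f (L n)) (L m)).
  { intros n m L'. induction L'; [left | right]; auto. }
  exists (fun n => f (L n)). split; [intros n; apply Hf |].
  intros n m E. destruct (lt_eq_lt_dec n m) as [[H | H] | H]; auto; exfalso.
  - apply (Hf (L m)). rewrite <- E. auto.
  - apply (Hf (L n)). rewrite E. auto.
Qed.

(** Otherwise the open sets that the sequence eventually avoids cover [K]; finitely many of them
    suffice, and a term of large index lies in none. *)
Lemma compact_accumulation_point {X : Type} {op : (X -> Prop) -> Prop} (K : X -> Prop)
  (x : nat -> X) :
  compact_subset op K -> (forall n, K (x n)) ->
  exists p, forall U, op U -> U p -> forall N, exists n, (N <= n)%nat /\ U (x n).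
Proof.
  intros HK Kx. apply NNPP. intros H.
  destruct (HK (fun U => op U /\ exists N, forall n, (N <= n)%nat -> ~ U (x n))) as (l & Hl & Hc).
  - tauto.
  - intros p _. apply NNPP. intros Hp. apply H. exists p. intros U HU Up N.
    apply NNPP. intros HN. apply Hp. exists U. repeat split; auto.
    exists N. intros n Hn Ux. eauto.
  - assert (HN : exists N, forall U, In U l -> forall n, (N <= n)%nat -> ~ U (x n)).
    { clear Hc. induction l as [| U l IH].
      - exists 0%nat. intros U [].
      - destruct IH as (N & HN). { intros V HV; apply Hl; right; auto. }
        destruct (Hl U (or_introl eq_refl)) as (_ & N' & HN').
        exists (Nat.max N N'). intros V [<- | HV] n Hn; [apply HN' | apply HN; auto]; lia. }
    destruct HN as (N & HN). destruct (Hc (x N) (Kx N)) as (U & HU & Ux).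
    exact (HN U HU N (le_n N) Ux).
Qed.

(** * Topological groups *)

Section TopologicalGroup.
Local Open Scope nat_scope.
Context {G : Type} {op : (G -> Prop) -> Prop} {mul : G -> G -> G} {inv : G -> G} {e : G}
  (tg : is_topological_group op mul inv e).
Local Infix "**" := mul (at level 40, left associativity).

Local Notation top := (proj1 tg).

Lemma mulA x y z : x ** y ** z = x ** (y ** z).
Proof. symmetry. apply tg. Qed.

Lemma mul1g x : e ** x = x.
Proof. apply tg. Qed.

Lemma mulg1 x : x ** e = x.
Proof. apply tg. Qed.

Lemma mulVg x : inv x ** x = e.
Proof. apply tg. Qed.

Lemma mulgV x : x ** inv x = e.
Proof. apply tg. Qed.

Lemma mulKg x y : inv x ** (x ** y) = y.
Proof. rewrite <- mulA, mulVg. apply mul1g. Qed.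

Lemma mulKVg x y : x ** (inv x ** y) = y.
Proof. rewrite <- mulA, mulgV. apply mul1g. Qed.

Lemma mulg_eq_inv x y : x ** y = e -> y = inv x.
Proof. intros H. rewrite <- (mulKg x y), H. apply mulg1. Qed.

Lemma invgK x : inv (inv x) = x.
Proof. symmetry. apply mulg_eq_inv. apply mulVg. Qed.

Lemma invMg x y : inv (x ** y) = inv y ** inv x.
Proof. symmetry. apply mulg_eq_inv. rewrite mulA, mulKVg. apply mulgV. Qed.

Lemma inv1g : inv e = e.
Proof. symmetry. apply mulg_eq_inv. apply mul1g. Qed.

#[local] Hint Rewrite mulA mul1g mulg1 mulVg mulgV mulKg mulKVg invgK invMg inv1g : grp.
Local Ltac grp := autorewrite with grp; try reflexivity.
Local Ltac grp_in H := autorewrite with grp in H.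

Lemma divg_eq1 x y : inv x ** y = e -> x = y.
Proof. intros H. rewrite <- (mulKVg x y), H. grp. Qed.

Lemma mul_continuous_at U x y :
  op U -> U (x ** y) ->
  exists V W, op V /\ op W /\ V x /\ W y /\ forall a b, V a -> W b -> U (a ** b).
Proof.
  intros HU Uxy. pose proof tg as (_ & _ & Hm & _).
  destruct (Hm U HU (x, y) Uxy) as (V & W & HV & HW & Vx & Wy & H).
  exists V, W. repeat split; auto. intros a b Va Wb. exact (H (a, b) Va Wb).
Qed.

Lemma open_mull a U : op U -> op (fun y => U (a ** y)).
Proof.
  intros HU. apply (open_local top). intros y Uy.
  destruct (mul_continuous_at U a y HU Uy) as (V & W & _ & HW & Va & Wy & H). eauto.
Qed.

Lemma open_mulr a U : op U -> op (fun y => U (y ** a)).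
Proof.
  intros HU. apply (open_local top). intros y Uy.
  destruct (mul_continuous_at U y a HU Uy) as (V & W & HV & _ & Vy & Wa & H). eauto.
Qed.

Lemma open_inv U : op U -> op (fun y => U (inv y)).
Proof. apply tg. Qed.

Lemma closed_mull a C : is_closed op C -> is_closed op (fun y => C (a ** y)).
Proof. intros HC. exact (open_mull a _ HC). Qed.

Lemma compact_mull a K : compact_subset op K -> compact_subset op (fun y => K (a ** y)).
Proof.
  intros HK F HF Cov.
  destruct (HK (fun U => exists U', F U' /\ U = fun y => U' (inv a ** y))) as (l & Hl & Hc).
  - intros U (U' & FU & ->). apply open_mull; auto.
  - intros x Kx. destruct (Cov (inv a ** x)) as (U & FU & Ux); [grp; auto |].
    exists (fun y => U (inv a ** y)). eauto.
  - exists (map (fun U y => U (a ** y)) l). split.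
    + intros U HU. apply in_map_iff in HU. destruct HU as (V & <- & HV).
      destruct (Hl V HV) as (U' & FU' & ->).
      replace (fun y => U' (inv a ** (a ** y))) with U'; auto.
      apply functional_extensionality. intros y. grp.
    + intros x Kx. destruct (Hc _ Kx) as (U & HU & Ux).
      exists (fun y => U (a ** y)). split; auto.
      apply (in_map (fun U y => U (a ** y))). exact HU.
Qed.

Lemma converges_mull a x p : converges op x p -> converges op (fun n => a ** x n) (a ** p).
Proof. intros Cv U HU Up. exact (Cv _ (open_mull a U HU) Up). Qed.

(** * Nested symmetric neighbourhoods of the identity *)

Lemma symmetric_cube_nbhd U :
  op U -> U e -> exists V, op V /\ V e /\ (forall x, V x -> V (inv x)) /\
    forall x y z, V x -> V y -> V z -> U (x ** y ** z).
Proof.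
  intros HU Ue.
  destruct (mul_continuous_at U e e HU) as (A & B & HA & HB & Ae & Be & HAB); [grp; auto |].
  destruct (mul_continuous_at A e e HA) as (C & D & HC & HD & Ce & De & HCD); [grp; auto |].
  set (W := fun x => B x /\ C x /\ D x).
  assert (HW : op W) by (repeat apply (open_and top); auto).
  exists (fun x => W x /\ W (inv x)). split; [| split; [| split]].
  - apply (open_and top); auto. apply open_inv; auto.
  - unfold W. grp. tauto.
  - intros x. grp. tauto.
  - unfold W. intros x y z Hx Hy Hz. apply HAB; [apply HCD |]; tauto.
Qed.

(** Three factors rather than two serve the metric, where a chain of factors is cut into a left
    part, one middle term and a right part. The intersection of all [V n] is a closed subgroup. *)
Definition nested_nbhds (V : nat -> G -> Prop) : Prop :=
  forall n, op (V n) /\ V n e /\ (forall x, V n x -> V n (inv x)) /\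
    forall x y z, V (S n) x -> V (S n) y -> V (S n) z -> V n (x ** y ** z).

Lemma nested_nbhds_refine (U : nat -> G -> Prop) :
  (forall n, op (U n)) -> (forall n, U n e) ->
  exists V, nested_nbhds V /\ forall n x, V n x -> U n x.
Proof.
  intros HU Ue.
  (* [f (n, W)] is a neighbourhood inside [U n] whose cube lies in [W]. The premises on [W] make the
     choice total; when they fail, the value is arbitrary. *)
  destruct (choice_fun (fun (nW : nat * (G -> Prop)) V => let (n, W) := nW in
      op W -> W e -> op V /\ V e /\ (forall x, V x -> V (inv x)) /\
      (forall x y z, V x -> V y -> V z -> W (x ** y ** z)) /\ forall x, V x -> U n x))
    as (f & Hf).
  { intros (n & W). destruct (classic (op W /\ W e)) as [(HW & We) | N].
    - destruct (symmetric_cube_nbhd (fun x => W x /\ U n x)) as (V & H1 & H2 & H3 & H4);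
        [apply (open_and top) | |]; auto.
      exists V. intros _ _. split; [auto | split; [auto | split; [auto | split]]].
      + intros x y z Vx Vy Vz. apply H4; auto.
      + intros x Vx. specialize (H4 x e e Vx H2 H2). grp_in H4. tauto.
    - exists W. tauto. }
  set (V := nat_rect (fun _ => G -> Prop) (f (0, U 0)) (fun n W => f (S n, W))).
  assert (HV : forall n, op (V n) /\ V n e).
  { induction n as [| n (H1 & H2)].
    - destruct (Hf (0, U 0) (HU 0) (Ue 0)) as (? & ? & _). auto.
    - destruct (Hf (S n, V n) H1 H2) as (? & ? & _). auto. }
  exists V. split.
  - intros n. destruct (HV n) as (H1 & H2). split; [auto | split; [auto | split]].
    + destruct n as [| n].
      * apply (Hf (0, U 0) (HU 0) (Ue 0)).
      * destruct (HV n) as (H3 & H4). apply (Hf (S n, V n) H3 H4).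
    + apply (Hf (S n, V n) H1 H2).
  - intros [| n].
    + apply (Hf (0, U 0) (HU 0) (Ue 0)).
    + destruct (HV n) as (H3 & H4). apply (Hf (S n, V n) H3 H4).
Qed.

Section NestedNbhds.
Context {V : nat -> G -> Prop} (HV : nested_nbhds V).

Lemma nested_mul n x y : V (S n) x -> V (S n) y -> V n (x ** y).
Proof.
  intros Hx Hy. destruct (HV n) as (_ & _ & _ & H). rewrite <- (mulg1 (x ** y)).
  apply H; auto. apply HV.
Qed.

Lemma nested_succ n x : V (S n) x -> V n x.
Proof. intros Hx. rewrite <- (mulg1 x). apply nested_mul; auto. apply HV. Qed.

Lemma nested_antitone n m x : n <= m -> V m x -> V n x.
Proof. intros L. induction L; auto. intros H. apply IHL, nested_succ, H. Qed.

(** If both [y] and [inv x ** y] lie in the symmetric set [V (S n)], then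
    [x = y ** inv (inv x ** y)] lies in its square. *)
Lemma nested_closure n x : closure op (V (S n)) x -> V n x.
Proof.
  intros Hx. destruct (Hx (fun y => V (S n) (inv x ** y))) as (y & H & Hy).
  - apply open_mull, HV.
  - grp. apply HV.
  - rewrite <- (invgK x). rewrite <- (mulKVg y (inv (inv x))).
    apply nested_mul; auto. replace (inv y ** inv (inv x)) with (inv (inv x ** y)) by grp.
    apply HV; auto.
Qed.

Lemma nested_inter_closed : is_closed op (fun x => forall n, V n x).
Proof.
  apply (open_ext top) with (fun x => ~ forall n, closure op (V n) x).
  - apply (closed_inter top). intros n. apply (closure_closed top).
  - intros x. apply not_iff_compat. split; intros H n.
    + apply nested_closure, H.
    + apply subset_closure, H.
Qed.

Lemma nested_inter_mul x y : (forall n, V n x) -> (forall n, V n y) -> forall n, V n (x ** y).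
Proof. intros Hx Hy n. apply nested_mul; auto. Qed.

Lemma nested_inter_inv x : (forall n, V n x) -> forall n, V n (inv x).
Proof. intros Hx n. apply HV; auto. Qed.

End NestedNbhds.

(** A common point [z] of the translates of [V] to [x] and to [y] would give [inv x ** y] as the
    product of [inv x ** z] and [inv (inv y ** z)], whereas products of elements of [V] avoid it. *)
Lemma topological_group_hausdorff : T1 op -> Hausdorff op.
Proof.
  intros T x y Hxy.
  destruct (symmetric_cube_nbhd (fun z => ~ z = inv x ** y)) as (V & HV & Ve & Vi & Vm).
  - apply T.
  - intros E. apply Hxy. symmetry in E. apply divg_eq1; auto.
  - exists (fun z => V (inv x ** z)), (fun z => V (inv y ** z)).
    repeat split; try (apply open_mull; auto); grp; auto.
    intros z Hx Hy. apply (Vm _ _ e Hx (Vi _ Hy) Ve). grp.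
Qed.

(* Katetov's argument for hereditarily normal products: the two separated sets are
   [X \ cl D] and [D], where [X] is a closed G_delta containing [e] and missing [D]. An open set [Q]
   about [D] pulls back along the right translations by the points of [D] to countably many
   neighbourhoods of [e]. *)
Lemma nested_nbhds_in_closure (D : nat -> G) :
  T1 op -> hereditarily_normal op -> (forall n, D n <> e) ->
  closure op (fun x => exists n, x = D n) e ->
  exists V, nested_nbhds V /\
    (forall x, (forall n, V n x) -> closure op (fun y => exists n, y = D n) x) /\
    (forall k, ~ forall n, V n (D k)).
Proof.
  intros T HN De clDe. set (R := fun x => exists n, x = D n) in *.
  destruct (nested_nbhds_refine (fun n x => ~ x = D n)) as (V0 & HV0 & HD0).
  { intros n. apply T. }
  { intros n E. apply (De n). auto. }
  assert (ND : forall k, ~ forall n, V0 n (D k)).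
  { intros k H. apply (HD0 k (D k)); auto. }
  destruct (hereditarily_normal_differences top _ _ HN (nested_inter_closed HV0)
    (closure_closed top R)) as (P & Q & HP & HQ & XP & DQ & Dis).
  assert (QD : forall n, Q (D n)).
  { intros n. apply DQ; [apply subset_closure; exists n |]; auto. }
  destruct (nested_nbhds_refine (fun n x => V0 n x /\ Q (x ** D n))) as (V & HV & HVQ).
  { intros n. apply (open_and top); [apply HV0 | apply open_mulr; auto]. }
  { intros n. split; [apply HV0 | grp; auto]. }
  exists V. split; [auto | split].
  - intros x Hx. apply NNPP. intros Nx.
    assert (Px : P x). { apply XP; auto. intros n. apply HVQ; auto. }
    (* Since [e] is in the closure of [D], some [x ** D n] falls into the neighbourhood [P] of [x],
       while [V n x] puts the same point into [Q]. *)
    destruct (clDe (fun y => P (x ** y))) as (y & Py & (n & ->)).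
    + apply open_mull; auto.
    + grp. auto.
    + apply (Dis (x ** D n)); auto. apply HVQ; auto.
  - intros k H. apply (ND k). intros n. apply HVQ; auto.
Qed.

Lemma nested_nbhds_trivial_inter :
  T1 op -> hereditarily_normal op -> has_nontrivial_conv_seq op ->
  exists V, nested_nbhds V /\ forall x, (forall n, V n x) -> x = e.
Proof.
  intros T HN HS. assert (Hd := topological_group_hausdorff T).
  destruct (sequence_of_conv_seq op HS) as (x & p & Cv & Np).
  apply (converges_mull (inv p)) in Cv. grp_in Cv.
  set (D := fun n => inv p ** x n) in *.
  assert (De : forall n, D n <> e).
  { intros n E. apply (Np n). symmetry. apply divg_eq1. exact E. }
  destruct (nested_nbhds_in_closure D T HN De) as (V & HV & H1 & H2).
  { intros U HU Ue. destruct (Cv U HU Ue) as (N & HN'). exists (D N). split; eauto. }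
  exists V. split; auto. intros y Hy.
  (* Adding the limit [e] to the range of [D] gives a closed set, so the intersection of the [V n]
     lies in it; it misses [D], which leaves only [e]. *)
  destruct (closure_min (op := op) (fun z => exists n, z = D n)
    (fun z => z = e \/ exists n, z = D n)) with y as [E | (n & ->)]; auto.
  - apply (convergent_range_closed top T Hd D e); auto.
  - destruct (H2 n Hy).
Qed.

Lemma nested_nbhds_G_delta_diagonal V :
  nested_nbhds V -> (forall x, (forall n, V n x) -> x = e) -> G_delta_diagonal op.
Proof.
  intros HV Ht. exists (fun n p => V n (inv (fst p) ** snd p)). split.
  - intros n (x & y) Hxy; simpl in *.
    destruct (mul_continuous_at (V n) (inv x) y) as (A & B & HA & HB & Ax & By & H);
      [apply HV | auto |].
    exists (fun z => A (inv z)), B. repeat split; auto. apply open_inv; auto.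
  - intros (x & y); simpl. split.
    + intros -> n. grp. apply HV.
    + intros H. apply divg_eq1. apply Ht. exact H.
Qed.

(** * The Birkhoff-Kakutani metric *)

Section Prenorm.
Local Open Scope R_scope.
Context {V : nat -> G -> Prop} (HV : nested_nbhds V) (V0 : forall x, V 0%nat x).

(** A pair [(n, g)] is a factor [g] declared to lie in [V n], at cost 2^-n. The prenorm of [x] will
    be the infimum of the weights of the valid chains with product [x]; as [V 0] is everything, a
    chain of weight 1 always exists. *)
Let weight (l : list (nat * G)) : R := fold_right (fun p s => (/ 2) ^ fst p + s) 0 l.
Let product (l : list (nat * G)) : G := fold_right (fun p g => snd p ** g) e l.
Let valid (l : list (nat * G)) : Prop := Forall (fun p => V (fst p) (snd p)) l.

Lemma half_pow_pos n : 0 < (/ 2) ^ n.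
Proof. apply pow_lt. lra. Qed.

Lemma weight_app l1 l2 : weight (l1 ++ l2) = weight l1 + weight l2.
Proof. unfold weight. induction l1 as [| p l1 IH]; simpl; [ring | rewrite IH; ring]. Qed.

Lemma weight_pos l : 0 <= weight l.
Proof.
  unfold weight. induction l as [| p l IH]; simpl; [lra |].
  pose proof (half_pow_pos (fst p)). lra.
Qed.

Lemma product_app l1 l2 : product (l1 ++ l2) = product l1 ** product l2.
Proof. unfold product. induction l1 as [| p l1 IH]; simpl; [grp | rewrite IH; grp]. Qed.

(** [p] is the term at which the running weight first exceeds [s]. *)
Lemma split_by_weight l s :
  0 <= s -> s < weight l ->
  exists l1 p l2, l = l1 ++ p :: l2 /\ weight l1 <= s /\ s < weight l1 + (/ 2) ^ fst p.
Proof.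
  revert s. induction l as [| p l IH]; simpl; intros s Hs Hw; [lra |].
  destruct (Rlt_le_dec s ((/ 2) ^ fst p)) as [L | L].
  - exists nil, p, l. simpl. repeat split; lra.
  - destruct (IH (s - (/ 2) ^ fst p)) as (l1 & q & l2 & -> & H1 & H2); [lra | lra |].
    exists (p :: l1), q, l2. simpl. repeat split; lra.
Qed.

(* Frink's lemma: cut the chain at half of its weight, so that [V (S n)] contains the products of
   both sides and the middle term. *)
Lemma nested_of_weight l n : valid l -> weight l < (/ 2) ^ n -> V n (product l).
Proof.
  assert (H : forall N l n, (length l <= N)%nat -> valid l -> weight l < (/ 2) ^ n ->
    V n (product l)); [| apply (H (length l)); auto].
  clear l n. induction N as [| N IH]; intros l n HN Hl Hw.
  - destruct l; [apply HV | simpl in HN; lia].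
  - destruct l as [| q l]; [apply HV |].
    set (l' := q :: l) in *.
    assert (Pos : 0 < weight l').
    { simpl. pose proof (half_pow_pos (fst q)). pose proof (weight_pos l). lra. }
    destruct (split_by_weight l' (weight l' / 2)) as (l1 & p & l2 & E & H1 & H2); [lra | lra |].
    clearbody l'. subst l'. rewrite weight_app in *. rewrite product_app.
    rewrite length_app in HN. simpl in *.
    apply Forall_app in Hl. destruct Hl as (Hl1 & Hl2).
    inversion Hl2 as [| ? ? Hp Hl2']; subst.
    pose proof (weight_pos l1). pose proof (weight_pos l2). pose proof (half_pow_pos (fst p)).
    rewrite <- mulA. apply HV.
    + apply IH; auto; simpl; [lia | lra].
    + apply (nested_antitone HV) with (fst p); auto.
      destruct (le_lt_dec (S n) (fst p)) as [L | L]; auto. exfalso.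
      (* The middle term weighs no more than the whole chain, hence less than 2^-n, so its level is
         at least [S n]. *)
      assert ((/ 2) ^ n <= (/ 2) ^ fst p); [| lra].
      replace n with ((n - fst p) + fst p)%nat by lia. rewrite pow_add.
      rewrite <- (Rmult_1_l ((/ 2) ^ fst p)) at 2. apply Rmult_le_compat_r; [lra |].
      rewrite <- (pow1 (n - fst p)). apply pow_incr. lra.
    + apply IH; auto; simpl; [lia | lra].
Qed.

Lemma greatest_lower_bound (E : R -> Prop) :
  (exists x, E x) -> (forall x, E x -> 0 <= x) ->
  exists m, (forall x, E x -> m <= x) /\ forall b, (forall x, E x -> b <= x) -> b <= m.
Proof.
  intros (x0 & Hx0) Hpos.
  destruct (completeness (fun x => E (- x))) as (m & Hub & Hlub).
  - exists 0. intros x Hx. specialize (Hpos _ Hx). lra.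
  - exists (- x0). rewrite Ropp_involutive. exact Hx0.
  - exists (- m). split.
    + intros x Hx. assert (- x <= m); [| lra]. apply Hub. rewrite Ropp_involutive. exact Hx.
    + intros b Hb. assert (m <= - b); [| lra]. apply Hlub. intros x Hx. specialize (Hb _ Hx). lra.
Qed.

(** Concatenating chains gives subadditivity, one-term chains bound [p] on [V n], and
    [nested_of_weight] gives the converse inclusion. *)
Lemma prenorm_exists :
  exists p : G -> R, (forall x, 0 <= p x) /\ p e = 0 /\
    (forall x y, p (x ** y) <= p x + p y) /\
    (forall n x, p x < (/ 2) ^ n -> V n x) /\ (forall n x, V n x -> p x <= (/ 2) ^ n).
Proof.
  set (E := fun x r => exists l, valid l /\ product l = x /\ weight l = r).
  destruct (choice_fun (fun x m => (forall r, E x r -> m <= r) /\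
    forall b, (forall r, E x r -> b <= r) -> b <= m)) as (p & Hp).
  { intros x. apply greatest_lower_bound.
    - exists (weight ((0%nat, x) :: nil)). exists ((0%nat, x) :: nil). repeat split.
      + repeat constructor. apply V0.
      + simpl. grp.
    - intros r (l & _ & _ & <-). apply weight_pos. }
  assert (Pos : forall x, 0 <= p x).
  { intros x. apply Hp. intros r (l & _ & _ & <-). apply weight_pos. }
  exists p. split; [auto | split; [| split; [| split]]].
  - apply Rle_antisym; auto. apply Hp. exists nil. repeat split. constructor.
  - intros x y.
    assert (H : forall r s, E x r -> E y s -> p (x ** y) <= r + s).
    { intros r s (l & Hl & <- & <-) (l' & Hl' & <- & <-). apply Hp. exists (l ++ l').
      rewrite product_app, weight_app. repeat split. apply Forall_app; auto. }
    assert (H' : forall s, E y s -> p (x ** y) - p x <= s).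
    { intros s Hs. assert (p (x ** y) - s <= p x); [| lra]. apply Hp. intros r Hr.
      specialize (H r s Hr Hs). lra. }
    apply Hp in H'. lra.
  - intros n x Hx. apply NNPP. intros Nx. apply (Rlt_not_le _ _ Hx). apply Hp.
    intros r (l & Hl & <- & <-). apply Rnot_lt_le. intros L. apply Nx.
    apply nested_of_weight; auto.
  - intros n x Hx. apply Hp. exists ((n, x) :: nil). repeat split.
    + repeat constructor. exact Hx.
    + simpl. grp.
    + simpl. ring.
Qed.

End Prenorm.

(** The [V n] need not form a base at [e] in [G]. But inside the compact [K] the closures of the
    translates of the [V n] to [x] decrease to [x] alone, so each neighbourhood of [x] contains the
    trace of one of them. *)
Lemma compact_metrizable V K :
  nested_nbhds V -> (forall x, (forall n, V n x) -> x = e) -> compact_subset op K ->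
  metrizable (subspace op K).
Proof.
  intros HV Ht HK.
  (* The whole group is inserted at level 0, so that every element has a chain. *)
  set (W := fun n => match n with 0 => fun _ : G => True | S n => V n end).
  assert (HW : nested_nbhds W).
  { intros [| n]; [| apply HV]. repeat split; auto. apply (open_true top). }
  assert (HtW : forall x, (forall n, W n x) -> x = e).
  { intros x Hx. apply Ht. intros n. apply (Hx (S n)). }
  destruct (prenorm_exists HW (fun _ => I)) as (p & Pos & Pe & Psub & P1 & P2).
  (* The prenorm is not claimed to be symmetric, so both orders are added; this is also why
     [eps / 2] appears below. *)
  exists (fun x y => p (inv (proj1_sig x) ** proj1_sig y) + p (inv (proj1_sig y) ** proj1_sig x))%R.
  split; [split; [| split; [| split]] |].
  - intros x y. apply Rplus_le_le_0_compat; apply Pos.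
  - intros (x & Kx) (y & Ky); simpl. split.
    + intros H. assert (E : x = y).
      { apply divg_eq1. apply HtW. intros n. apply P1.
        pose proof (Pos (inv x ** y)). pose proof (Pos (inv y ** x)).
        pose proof (half_pow_pos n). lra. }
      subst y. rewrite (proof_irrelevance _ Kx Ky). reflexivity.
    + intros E. apply (f_equal (@proj1_sig _ _)) in E. simpl in E. subst y. grp.
      rewrite Pe. ring.
  - intros x y. apply Rplus_comm.
  - intros (x & Kx) (y & Ky) (z & Kz); simpl.
    pose proof (Psub (inv x ** y) (inv y ** z)) as H1. pose proof (Psub (inv z ** y) (inv y ** x)) as H2.
    grp_in H1. grp_in H2. lra.
  - intros U. split.
    + intros (U' & HU & EU) (x & Kx) Ux.
      destruct (compact_antitone (op := op) K (fun n y => closure op (W n) (inv x ** y)) U')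
          as (n & Hn); auto.
      * intros n. apply (closed_mull (inv x)). apply (closure_closed top).
      * intros n y Hy. apply subset_closure. apply (nested_closure HW). exact Hy.
      * intros y Ky Hy. replace y with x; [apply EU in Ux; exact Ux |].
        apply divg_eq1. apply HtW. intros n. apply (nested_closure HW). apply Hy.
      * exists ((/ 2) ^ n)%R. split; [apply half_pow_pos |].
        intros (y & Ky) Hy; simpl in *. apply EU. simpl. apply Hn; auto.
        apply subset_closure. apply P1. pose proof (Pos (inv y ** x)). lra.
    + intros HU.
      exists (fun z => exists O, op O /\ O z /\ forall y : {x | K x}, O (proj1_sig y) -> U y). split.
      * apply (open_local top). intros z (O & HO & Oz & H).
        exists O. repeat split; auto. intros y Oy. exists O. auto.
      * intros (x & Kx); simpl. split.
        -- intros Ux. destruct (HU _ Ux) as (eps & He & Hb).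
           destruct (pow_lt_1_zero (/ 2)) with (y := (eps / 2)%R) as (n & Hn).
           { rewrite Rabs_pos_eq; lra. }
           { lra. }
           specialize (Hn n (le_n n)). rewrite Rabs_pos_eq in Hn by (apply Rlt_le, half_pow_pos).
           exists (fun z => W n (inv x ** z)). split; [| split].
           ++ apply open_mull. apply HW.
           ++ grp. apply HW.
           ++ intros (y & Ky) Hy; simpl in *. apply Hb; simpl.
              pose proof (P2 _ _ Hy). apply HW in Hy. grp_in Hy. pose proof (P2 _ _ Hy). lra.
        -- intros (O & HO & Ox & H). apply (H (exist _ x Kx)). exact Ox.
Qed.

(** * Sequences of cosets *)

Definition is_subgroup (M : G -> Prop) : Prop :=
  M e /\ (forall x y, M x -> M y -> M (x ** y)) /\ (forall x, M x -> M (inv x)).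

Definition converges_to_set (x : nat -> G) (M : G -> Prop) : Prop :=
  forall O, op O -> (forall m, M m -> O m) -> exists N, forall n, N <= n -> O (x n).

(** The tube lemma for multiplication: finitely many right factors cover [M], and the corresponding
    left neighbourhoods of [x] are intersected. *)
Lemma open_translates_into M O :
  compact_subset op M -> op O -> op (fun x => forall m, M m -> O (x ** m)).
Proof.
  intros HM HO. apply (open_local top). intros x Hx.
  destruct (HM (fun Q => op Q /\ exists P, op P /\ P x /\ forall a b, P a -> Q b -> O (a ** b)))
    as (l & Hl & Hc).
  - tauto.
  - intros m Mm. destruct (mul_continuous_at O x m HO (Hx m Mm)) as (P & Q & HP & HQ & Px & Qm & H).
    exists Q. split; eauto.
  - assert (HP : exists P, op P /\ P x /\ forall a b Q, P a -> In Q l -> Q b -> O (a ** b)).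
    { clear Hc. induction l as [| Q l IH].
      - exists (fun _ => True). split; [apply (open_true top) | split; [exact I | intros a b Q _ []]].
      - destruct IH as (P & HP & Px & H). { intros Q' HQ'; apply Hl; right; auto. }
        destruct (Hl Q (or_introl eq_refl)) as (_ & P' & HP' & Px' & H').
        exists (fun y => P y /\ P' y). split; [apply (open_and top); auto | split; [auto |]].
        intros a b Q' (Pa & Pa') [<- | HQ'] Qb; eauto. }
    destruct HP as (P & HP & Px & H). exists P. split; [auto | split; [auto |]].
    intros y Py m Mm. destruct (Hc m Mm) as (Q & HQ & Qm). eauto.
Qed.

(** Elements of [M] translate [M] into itself, so [M] lies in the open set of points that translate
    [M] into [O]. Control of whole cosets is what allows representatives to be changed later. *)
Lemma cosets_converge_to_subgroup x M :
  compact_subset op M -> is_subgroup M -> converges_to_set x M ->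
  forall O, op O -> (forall m, M m -> O m) ->
  exists N, forall n, N <= n -> forall m, M m -> O (x n ** m).
Proof.
  intros HK HM Cv O HO MO. apply (Cv _ (open_translates_into M O HK HO)).
  intros m Mm m' Mm'. apply MO. apply HM; auto.
Qed.

(* Sequences of cosets [rep n ** stab] converging to the subgroup [stab]. Shrinking [stab] to a
   point by Zorn's lemma turns such a sequence into a convergent sequence of points. *)
Record coset_sequence (N0 : G -> Prop) : Type := CosetSequence {
  stab : G -> Prop;
  rep : nat -> G;
  stab_subgroup : is_subgroup stab;
  stab_closed : is_closed op stab;
  stab_sub : forall x, stab x -> N0 x;
  rep_outside : forall n, ~ N0 (rep n);
  rep_converges : converges_to_set rep stab }.
Arguments stab {N0}.
Arguments rep {N0}.

(** Each coset of [t] lies in the coset of [s] with the same index. *)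
Definition refines {N0} (s t : coset_sequence N0) : Prop :=
  (forall x, stab t x -> stab s x) /\ forall n, stab s (inv (rep s n) ** rep t n).

Section CosetSequences.
Context {N0 : G -> Prop} (HN0 : is_subgroup N0) (KN0 : compact_subset op N0).

Lemma stab_compact (s : coset_sequence N0) : compact_subset op (stab s).
Proof.
  apply compact_subset_closed with N0; [exact KN0 | apply stab_closed | apply stab_sub].
Qed.

Lemma refines_refl (s : coset_sequence N0) : refines s s.
Proof. split; auto. intros n. grp. apply stab_subgroup. Qed.

Lemma refines_trans (r s t : coset_sequence N0) : refines r s -> refines s t -> refines r t.
Proof.
  intros (H1 & H2) (H3 & H4). split; auto. intros n.
  replace (inv (rep r n) ** rep t n)
    with (inv (rep r n) ** rep s n ** (inv (rep s n) ** rep t n)) by grp.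
  apply stab_subgroup; auto.
Qed.

Lemma mul_rep_outside (s : coset_sequence N0) z n : stab s z -> ~ N0 (rep s n ** z).
Proof.
  intros Hz H. apply (rep_outside _ s n).
  replace (rep s n) with (rep s n ** z ** inv z) by grp.
  apply HN0; auto. apply HN0. apply (stab_sub _ s). exact Hz.
Qed.

(** The bound has the intersection [M] of the stabilizers, and its [n]-th point lies in all [n]-th
    cosets. Convergence survives because, by compactness, an open set about [M] already contains one
    [stab s], and then almost all cosets of [s]. *)
Lemma refines_chain_bound (A : coset_sequence N0 -> Prop) (s0 : coset_sequence N0) :
  A s0 -> (forall s t, A s -> A t -> refines s t \/ refines t s) ->
  exists t, forall s, A s -> refines s t.
Proof.
  intros As0 Tot. set (M := fun x => forall s, A s -> stab s x).
  assert (Hx : forall n, exists y, forall s, A s -> stab s (inv (rep s n) ** y)).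
  { intros n. apply NNPP. intros Nx.
    destruct (compact_directed (op := op) (fun y => stab s0 (inv (rep s0 n) ** y))
      (fun C => exists s, A s /\ C = fun y => stab s (inv (rep s n) ** y)) (fun _ => False))
      as (C & (s & As & ->) & HC).
    - apply compact_mull. apply stab_compact.
    - exists (fun y => stab s0 (inv (rep s0 n) ** y)), s0. auto.
    - intros C (s & As & ->). apply (closed_mull (inv (rep s n))). apply stab_closed.
    - intros C D (s & As & ->) (t & At & ->).
      assert (Sub : forall s t : coset_sequence N0, refines s t ->
        forall y, stab t (inv (rep t n) ** y) -> stab s (inv (rep s n) ** y)).
      { intros s' t' (H1 & H2) y Hy.
        replace (inv (rep s' n) ** y)
          with (inv (rep s' n) ** rep t' n ** (inv (rep t' n) ** y)) by grp.
        apply stab_subgroup; auto. }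
      destruct (Tot s t As At) as [R | R].
      + exists (fun y => stab t (inv (rep t n) ** y)). split; [exists t; auto |].
        intros y Hy. split; [exact (Sub s t R y Hy) | exact Hy].
      + exists (fun y => stab s (inv (rep s n) ** y)). split; [exists s; auto |].
        intros y Hy. split; [exact Hy | exact (Sub t s R y Hy)].
    - apply (open_local top). intros x [].
    - intros y _ H. apply Nx. exists y. intros s As.
      apply (H (fun y => stab s (inv (rep s n) ** y))). exists s. auto.
    (* The cosets of [s0] and [s] are nested, so the representative of the smaller one lies in
       both. *)
    - destruct (Tot s0 s As0 As) as [(H1 & H2) | (H1 & H2)].
      + apply (HC (rep s n)); auto. grp. apply stab_subgroup.
      + apply (HC (rep s0 n)); auto. grp. apply stab_subgroup. }
  destruct (choice_fun _ Hx) as (x & Rx).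
  assert (SM : is_subgroup M).
  { split; [| split].
    - intros s As. apply stab_subgroup.
    - intros a b Ma Mb s As. apply stab_subgroup; auto.
    - intros a Ma s As. apply stab_subgroup; auto. }
  assert (CM : is_closed op M).
  { apply (open_ext top) with
      (fun z => ~ forall s : {s | A s}, stab (proj1_sig s) z).
    - apply (closed_inter top (fun s : {s | A s} => stab (proj1_sig s))).
      intros s. apply stab_closed.
    - intros z. apply not_iff_compat. split.
      + intros H s As. apply (H (exist _ s As)).
      + intros H (s & As). apply H; auto. }
  assert (Out : forall n, ~ N0 (x n)).
  { intros n. replace (x n) with (rep s0 n ** (inv (rep s0 n) ** x n)) by grp.
    apply mul_rep_outside. auto. }
  assert (Cv : converges_to_set x M).
  { intros O HO MO.
    destruct (compact_directed (op := op) N0 (fun C => exists s, A s /\ C = stab s) O)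
      as (C & (s & As & ->) & HC); auto.
    - eauto.
    - intros C (s & _ & ->). apply stab_closed.
    - intros C D (s & As & ->) (t & At & ->).
      destruct (Tot s t As At) as [(R & _) | (R & _)]; [exists (stab t) | exists (stab s)];
        split; eauto.
    - intros y Ny H. apply MO. intros s As. apply H. eauto.
    - destruct (cosets_converge_to_subgroup (rep s) (stab s)) with O as (N & HN); auto.
      + apply stab_compact.
      + apply stab_subgroup.
      + apply rep_converges.
      + intros m Hm. apply HC; auto. apply (stab_sub _ s). exact Hm.
      + exists N. intros n Hn.
        replace (x n) with (rep s n ** (inv (rep s n) ** x n)) by grp. auto. }
  exists (CosetSequence N0 M x SM CM (fun z Mz => stab_sub _ s0 z (Mz s0 As0)) Out Cv).
  intros s As. split; simpl; auto.
Qed.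

(** The stabilizer is cut by a G_delta subgroup that misses [g]. New points still converge if each
    is taken as deep in the [V k] as its coset permits. *)
Lemma refines_step (s : coset_sequence N0) g :
  T1 op -> stab s g -> g <> e -> exists t, refines s t /\ ~ stab t g.
Proof.
  intros T Hg Ng. set (M := stab s) in *.
  assert (SM : is_subgroup M) by apply stab_subgroup.
  destruct (nested_nbhds_refine (fun _ x => ~ x = g)) as (V & HV & Vg).
  { intros _. apply T. }
  { intros _ E. apply Ng. auto. }
  set (M' := fun x => M x /\ forall n, V n x).
  destruct (choice_fun (fun n z => M z /\
    forall k, k <= n -> (exists m, M m /\ V k (rep s n ** m)) -> V k (rep s n ** z))) as (z & Hz).
  (* Only the bound on [k] is generalized: the induction finds the largest [k <= j] for which the
     fixed coset meets [V k]. *)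
  { intros n. generalize n at 1 as j. induction j as [| j IH].
    - destruct (classic (exists m, M m /\ V 0 (rep s n ** m))) as [(m & Mm & Vm) | Nm].
      + exists m. split; auto. intros k Hk _. replace k with 0 by lia. exact Vm.
      + exists e. split; [apply SM |]. intros k Hk H. replace k with 0 in H by lia. contradiction.
    - destruct (classic (exists m, M m /\ V (S j) (rep s n ** m))) as [(m & Mm & Vm) | Nm].
      + exists m. split; auto. intros k Hk _. apply (nested_antitone HV) with (S j); auto.
      + destruct IH as (m & Mm & H). exists m. split; auto. intros k Hk Hm.
        destruct (Nat.eq_dec k (S j)) as [-> | ?]; [contradiction |]. apply H; auto. lia. }
  assert (SM' : is_subgroup M').
  { split; [| split].
    - split; [apply SM | intros n; apply HV].
    - intros a b (Ma & Va) (Mb & Vb). split; [apply SM; auto | apply (nested_inter_mul HV); auto].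
    - intros a (Ma & Va). split; [apply SM; auto | apply (nested_inter_inv HV); auto]. }
  assert (CM' : is_closed op M').
  { apply (closed_and top); [apply stab_closed | apply (nested_inter_closed HV)]. }
  assert (Cv : converges_to_set (fun n => rep s n ** z n) M').
  { intros O HO MO.
    destruct (compact_antitone (op := op) M (fun n => closure op (V n)) O) as (k & Hk); auto.
    - apply stab_compact.
    - intros n. apply (closure_closed top).
    - intros n y Hy. apply subset_closure. apply (nested_closure HV). exact Hy.
    - intros y My Hy. apply MO. split; auto. intros n. apply (nested_closure HV). apply Hy.
    (* On [M] the closure of [V k] lies in [O], so [O] together with the complement of that closure
       is open about [M]. Almost all cosets lie in it, and almost all meet [V k]; then the chosen
       point is in [V k], hence in [O]. *)
    - destruct (cosets_converge_to_subgroup (rep s) M (stab_compact s) SM (rep_converges _ s)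
        (fun y => O y \/ ~ closure op (V k) y)) as (N1 & HN1).
      + apply (open_or top); auto. apply (closure_closed top).
      + intros m Mm. destruct (classic (closure op (V k) m)); auto.
      + destruct (rep_converges _ s (fun y => exists m, M m /\ V k (y ** m))) as (N2 & HN2).
        * apply (open_local top). intros y (m & Mm & Vm).
          exists (fun y => V k (y ** m)). split; [apply open_mulr; apply HV | eauto].
        * intros m Mm. exists (inv m). split; [apply SM; auto |]. grp. apply HV.
        * exists (Nat.max k (Nat.max N1 N2)). intros n Hn.
          destruct (HN1 n ltac:(lia) (z n)) as [On | Nn]; auto.
          -- apply Hz.
          -- exfalso. apply Nn. apply subset_closure. apply Hz; [lia |]. apply HN2. lia. }
  assert (Out : forall n, ~ N0 (rep s n ** z n)).
  { intros n. apply mul_rep_outside. apply Hz. }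
  exists (CosetSequence N0 M' _ SM' CM' (fun x Hx => stab_sub _ s x (proj1 Hx)) Out Cv).
  split.
  - split; simpl.
    + intros x Hx. apply Hx.
    + intros n. grp. apply Hz.
  - simpl. intros (_ & Vgg). apply (Vg 0 g); auto.
Qed.

(** A maximal coset sequence has trivial stabilizer: a refinement losing some [g] would in turn be
    refined by [s], which has [g]. Its representatives then converge to [e]. *)
Lemma coset_sequence_conv_seq (s0 : coset_sequence N0) : T1 op -> has_nontrivial_conv_seq op.
Proof.
  intros T.
  destruct (classical_sets.ZL_preorder s0
    (R := fun s t => boolp.asbool (refines s t))) as (s & Hs).
  - intros s. apply boolp.asboolT. apply refines_refl.
  - intros r s t Hrs Hst. apply boolp.asboolT.
    apply refines_trans with s; apply boolp.asboolW; assumption.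
  - intros A Tot. destruct (classic (exists s, A s)) as [(s & As) | NA].
    + destruct (refines_chain_bound A s As) as (t & Ht).
      * intros r t Ar At. destruct (Tot r t Ar At) as [H | H]; apply boolp.asboolW in H; auto.
      * exists t. intros r Ar. apply boolp.asboolT. auto.
    + exists s0. intros s As. destruct NA. eauto.
  - assert (Triv : forall g, stab s g -> g = e).
    { intros g Hg. apply NNPP. intros Ng.
      destruct (refines_step s g T Hg Ng) as (t & Hst & Nt). apply Nt.
      assert (Hts : refines t s).
      { apply boolp.asboolW. apply Hs. apply boolp.asboolT. exact Hst. }
      apply Hts. exact Hg. }
    apply (conv_seq_of_sequence op (rep s) e).
    + exact top.
    + apply topological_group_hausdorff. exact T.
    + intros U HU Ue. apply (rep_converges _ s U HU). intros m Hm.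
      rewrite (Triv m Hm). exact Ue.
    + intros n E. apply (rep_outside _ s n). rewrite E. apply HN0.
Qed.

End CosetSequences.

Lemma infinite_compact_conv_seq K :
  T1 op -> hereditarily_normal op -> compact_subset op K -> ~ finite_set K ->
  has_nontrivial_conv_seq op.
Proof.
  intros T HN HK Inf. assert (Hd := topological_group_hausdorff T).
  destruct (infinite_injective_sequence K Inf) as (x & Kx & Inj).
  destruct (compact_accumulation_point (op := op) K x HK Kx) as (p & Hp).
  (* By injectivity at most one term equals [p]; a tail avoids it and still accumulates at [p]. *)
  assert (Tail : exists N, forall n, N <= n -> x n <> p).
  { destruct (classic (exists n, x n = p)) as [(n & <-) | Nn].
    - exists (S n). intros m Hm E. apply Inj in E. lia.
    - exists 0. intros n _ E. apply Nn. eauto. }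
  destruct Tail as (N & HNp).
  set (D := fun n => inv p ** x (N + n)). set (L := fun y => K (p ** y)).
  assert (KL : compact_subset op L) by (apply compact_mull; exact HK).
  assert (DL : forall y, closure op (fun y => exists n, y = D n) y -> L y).
  { apply closure_min; [apply (compact_closed top); auto |].
    intros y (n & ->). unfold L, D. grp. apply Kx. }
  assert (clDe : closure op (fun y => exists n, y = D n) e).
  { intros U HU Ue. destruct (Hp (fun y => U (inv p ** y))) with N as (n & Hn & Un).
    - apply open_mull; auto.
    - grp. exact Ue.
    - exists (D (n - N)). split; eauto. unfold D. replace (N + (n - N)) with n by lia. exact Un. }
  destruct (nested_nbhds_in_closure D T HN) as (V & HV & VD & ND); auto.
  { intros n E. apply (HNp (N + n)); [lia |]. symmetry. apply divg_eq1. exact E. }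
  set (N0 := fun y => forall n, V n y).
  assert (SN0 : is_subgroup N0).
  { split; [intros n; apply HV | split].
    - exact (nested_inter_mul HV).
    - exact (nested_inter_inv HV). }
  assert (CN0 : is_closed op N0) by apply (nested_inter_closed HV).
  assert (KN0 : compact_subset op N0).
  { apply compact_subset_closed with L; auto. }
  (* As [e] is in the closure of [D], each [V n] contains a point of [D]. These points stay in the
     compact [L], where the closures of the [V n] decrease to [N0], so they converge to [N0]. *)
  destruct (choice_fun (fun n y => V n y /\ exists k, y = D k)) as (y & Hy).
  { intros n. apply clDe; apply HV. }
  assert (Out : forall n, ~ N0 (y n)).
  { intros n. destruct (Hy n) as (_ & k & ->). apply ND. }
  assert (Cv : converges_to_set y N0).
  { intros O HO NO.
    destruct (compact_antitone (op := op) L (fun n => closure op (V n)) O) as (k & Hk); auto.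
    - intros n. apply (closure_closed top).
    - intros n z Hz. apply subset_closure. apply (nested_closure HV). exact Hz.
    - intros z _ Hz. apply NO. intros n. apply (nested_closure HV). apply Hz.
    - exists k. intros n Hn. destruct (Hy n) as (Vn & Dn). apply Hk.
      + apply DL. apply subset_closure. exact Dn.
      + apply subset_closure. apply (nested_antitone HV) with n; auto. }
  exact (coset_sequence_conv_seq SN0 KN0 (CosetSequence N0 N0 y SN0 CN0 (fun _ H => H) Out Cv) T).
Qed.

End TopologicalGroup.

Theorem theorem2p10 (G : Type) (op : (G -> Prop) -> Prop)
  (mul : G -> G -> G) (inv : G -> G) (e : G) :
  is_topological_group op mul inv e -> T1 op -> hereditarily_normal op ->
  ((has_nontrivial_conv_seq op /\ G_delta_diagonal op) \/
   (~ has_nontrivial_conv_seq op /\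
    forall K : G -> Prop, compact_subset op K -> finite_set K)) /\
  (forall K : G -> Prop, compact_subset op K -> metrizable (subspace op K)).
Proof.
  intros tg T HN.
  destruct (classic (has_nontrivial_conv_seq op)) as [HS | NS].
  - destruct (nested_nbhds_trivial_inter tg T HN HS) as (V & HV & Ht). split.
    + left. split; auto. exact (nested_nbhds_G_delta_diagonal tg V HV Ht).
    + intros K. exact (compact_metrizable tg V K HV Ht).
  - assert (Fin : forall K, compact_subset op K -> finite_set K).
    { intros K HK. apply NNPP. intros Inf. apply NS.
      exact (infinite_compact_conv_seq tg K T HN HK Inf). }
    split; auto. intros K HK. apply (finite_compact_metrizable (proj1 tg)); auto.
Qed.
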